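(* For any odd prime $p$, $$\sum_{k=0}^{p-1}\left(-\frac{1}{8}\right)^k\sum_{j=0}^k\binom{2j}{j}\binom{2k-2j}{k-j}(6j+1)(6k-6j+1)\equiv -\frac{p}{2}\pmod{p^2},$$ and $$\sum_{k=0}^{p-1}\left(\frac{1}{4}\right)^k\sum_{j=0}^k\binom{2j}{j}\binom{2k-2j}{k-j}(6j+1)(6k-6j+1)\equiv p\pmod{p^2}.$$
   Context: Congruences are between rational numbers whose denominators are coprime to $p$: for such rationals $a,b$, $a\equiv b\pmod{p^2}$ means that the numerator of $a-b$, written in lowest terms, is divisible by $p^2$ (equivalently, $a-b\in p^2\mathbb{Z}_{(p)}$, where $\mathbb{Z}_{(p)}$ is the ring of rationals with denominator coprime to $p$). $\binom{a}{b}$ denotes the ordinary binomial coefficient. *)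

(* Defs.v *)
From mathcomp Require Import all_boot all_order all_algebra.

Set Implicit Arguments.
Unset Strict Implicit.
Unset Printing Implicit Defensive.

Import GRing.Theory Num.Theory.
Local Open Scope ring_scope.

(* Congruence of rationals whose denominators are coprime to the modulus.
   For m = p ^ 2, coprimality to m is coprimality to p; it is required of both
   sides, so that the relation implies that they lie in Z_(p).  numq and denq
   are the numerator and denominator in lowest terms. *)
Definition eqmodq (m : nat) (a b : rat) : bool :=
  [&& coprimez (denq a) m%:Z, coprimez (denq b) m%:Z
    & (m%:Z %| numq (a - b))%Z].

(* Main.v *)
Require Import Defs.
From mathcomp Require Import all_boot all_order all_algebra.
From mathcomp Require Import ring.

Import GRing.Theory Num.Theory.
Local Open Scope ring_scope.

(** The generating function of C(2j,j) (6j+1) is (1 + 8x) (1 - 4x)^(-3/2), whose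
    square is rational: the inner sum has the closed form
    4^k (9k^2 + 3k + 2) / 2 ([inner_sumE]).  Both outer sums can then be
    evaluated exactly: with x = 1/4 the summand is a quadratic polynomial in k,
    and the sum is p + 3 p^2 (p - 1) / 2 ([sum_quadratic]); with x = -1/8 it is
    such a polynomial times (-1/2)^k, and the sum telescopes to
    (3 p^2 - p) / 2^p ([sum_quadratic_geometric]).  The first value is p mod
    p^2 at once; the second is - p / 2 mod p^2 because 2^p = 2 mod p.

    The closed form is obtained without power series: (j+1) C(2j+2,j+1) =
    2 (2j+1) C(2j,j) turns into recurrences in k for the convolution of the
    central binomial coefficients and for its variant weighted by j (k-j). *)

Definition conv (f g : nat -> rat) (k : nat) : rat :=
  \sum_(0 <= j < k.+1) f j * g (k - j)%N.

(** This is x d/dx on the coefficients of a power series. *)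
Definition euler (f : nat -> rat) (j : nat) : rat := j%:R * f j.

Definition central (j : nat) : rat := 'C(2 * j, j)%:R.

Lemma convC f g k : conv f g k = conv g f k.
Proof.
rewrite /conv big_nat_rev /=; apply: eq_big_nat => j /andP[_ lt_jk].
by rewrite add0n subSS subKn // mulrC.
Qed.

(** The Leibniz rule for x d/dx, since j + (k - j) = k. *)
Lemma conv_euler f g k :
  conv (euler f) g k + conv f (euler g) k = k%:R * conv f g k.
Proof.
rewrite /conv /euler -big_split mulr_sumr /=.
apply: eq_big_nat => j /andP[_ lt_jk].
by rewrite natrB //; ring.
Qed.

(** By symmetry the weight j averages to k / 2. *)
Lemma conv_euler_same f k : 2%:R * conv (euler f) f k = k%:R * conv f f k.
Proof. by rewrite -conv_euler [conv f (euler f) k]convC; ring. Qed.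

(** The differential equation (x d/dx) F = x (4 (x d/dx) F + 2 F) of
    F = (1 - 4x)^(-1/2), on coefficients. *)
Lemma euler_central j : euler central j.+1 = (4 * j + 2)%:R * central j.
Proof.
have nat_eq : (j.+1 * 'C(2 * j.+1, j.+1) = (4 * j + 2) * 'C(2 * j, j))%N.
  have E1 := mul_bin_diag (2 * j.+1) j.
  have E2 := mul_bin_down (2 * j).+1 j.
  have e1 : (2 * j.+1 = (2 * j).+2)%N by rewrite mulnS.
  have e2 : ((2 * j).+1 - j = j.+1)%N by rewrite mul2n -addnn -addnS addKn.
  rewrite e1 /= e2 in E1 E2; rewrite e1 -E1 /=.
  have -> : (4 * j + 2 = 2 * (2 * j).+1)%N by rewrite mulnS addnC mulnA.
  by rewrite -mulnA E2 mulnA mulnS.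
by rewrite /euler /central -!natrM nat_eq.
Qed.

(** The same differential equation, multiplied by the series of g. *)
Lemma conv_euler_central g k :
  conv (euler central) g k.+1 =
    4%:R * conv (euler central) g k + 2%:R * conv central g k.
Proof.
rewrite {1}/conv big_nat_recl // {1}/euler !mul0r add0r.
rewrite /conv !mulr_sumr -big_split /=; apply: eq_bigr => j _.
by rewrite euler_central subSS /euler natrD natrM; ring.
Qed.

(** Let s k be this convolution.  Computing the convolution with weight j at k+1
    by symmetry and by the recurrence gives (k+1)/2 s (k+1) = 2 (k+1) s k. *)
Lemma conv_central k : conv central central k = 4%:R ^+ k.
Proof.
elim: k => [|k IHk].
  by rewrite /conv big_nat1 /central mulr1.
have k1_neq0 : k.+1%:R != 0 :> rat by rewrite pnatr_eq0.
apply: (mulfI k1_neq0); rewrite -conv_euler_same conv_euler_central.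
have := conv_euler_same central k; rewrite IHk => Ek.
transitivity (4%:R * (2%:R * conv (euler central) central k)
              + 4%:R * 4%:R ^+ k); first by ring.
by rewrite Ek exprS -natr1; ring.
Qed.

(** The recurrence for the weight j (k-j) involves the previous value and the
    convolution with weight j, which is k / 2 * 4^k. *)
Lemma conv_euler_central2 k :
  8%:R * conv (euler central) (euler central) k =
    4%:R ^+ k * (k%:R * (k%:R - 1)).
Proof.
elim: k => [|k IHk].
  by rewrite /conv big_nat1 /euler !mul0r !mulr0.
rewrite conv_euler_central [conv central _ k]convC mulrDr.
transitivity (4%:R * (8%:R * conv (euler central) (euler central) k)
              + 8%:R * (2%:R * conv (euler central) central k)); first by ring.
by rewrite IHk conv_euler_same conv_central exprS -natr1; ring.
Qed.

Lemma inner_sumE k :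
  \sum_(0 <= j < k.+1)
    ('C(2 * j, j) * 'C(2 * k - 2 * j, k - j)
      * (6 * j + 1) * (6 * k - 6 * j + 1))%N%:R
  = 4%:R ^+ k * (9%:R * k%:R ^+ 2 + 3%:R * k%:R + 2%:R) / 2%:R :> rat.
Proof.
(* (6j+1) (6(k-j)+1) = 36 j (k-j) + 6 k + 1. *)
transitivity (36%:R * conv (euler central) (euler central) k
              + (6%:R * k%:R + 1) * conv central central k).
  rewrite /conv !mulr_sumr -big_split /=; apply: eq_big_nat => j /andP[_ le_jk].
  rewrite -!mulnBr !natrM (natrD _ (6 * j)%N) (natrD _ (6 * (k - j))%N) !natrM.
  rewrite /euler /central natrB //.
  by ring.
have -> : 36%:R = 9%:R / 2%:R * 8%:R :> rat by [].
rewrite -(mulrA _ 8%:R) conv_euler_central2 conv_central.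
by field.
Qed.

Lemma sum_quadratic n :
  \sum_(0 <= k < n) (9%:R * k%:R ^+ 2 + 3%:R * k%:R + 2%:R) / 2%:R
  = n%:R + 3%:R * n%:R ^+ 2 * (n%:R - 1) / 2%:R :> rat.
Proof.
elim: n => [|n IHn]; first by rewrite big_geq // expr0n mulr0 !mul0r addr0.
by rewrite big_nat_recr //= IHn -natr1; field.
Qed.

Lemma sum_quadratic_geometric n :
  \sum_(0 <= k < n)
    (- 2%:R^-1) ^+ k * ((9%:R * k%:R ^+ 2 + 3%:R * k%:R + 2%:R) / 2%:R)
  = (- 2%:R^-1) ^+ n * (n%:R - 3%:R * n%:R ^+ 2) :> rat.
Proof.
elim: n => [|n IHn]; first by rewrite big_geq // expr0n mulr0 subr0 mulr0.
rewrite big_nat_recr //= IHn (exprS _ n) -[n.+1%:R]natr1.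
by field.
Qed.

(** The lowest-terms representation is obtained from n / d by cancelling a
    common factor k, and k is coprime to m because it divides d. *)
Lemma numq_denq_frac m d (n : int) :
  (0 < d)%N -> coprime d m ->
  coprimez (denq (n%:~R / d%:R)) m%:Z
  /\ ((m%:Z %| n)%Z -> (m%:Z %| numq (n%:~R / d%:R))%Z).
Proof.
move=> d_gt0 co_dm; rewrite -[d%:R]/(d%:Z%:~R).
have : coprimez d%:Z m%:Z by [].
have : d%:Z != 0 by rewrite eqz_nat -lt0n.
case: divqP => [_ /eqP // | k x _ _].
rewrite coprimezMl => /andP[co_km co_xm]; split=> //.
by rewrite Gauss_dvdzr // coprimez_sym.
Qed.

Lemma eqmodq_frac m d (a b : int) :
  (0 < d)%N -> coprime d m -> (m%:Z %| a - b)%Z ->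
  eqmodq m (a%:~R / d%:R) (b%:~R / d%:R).
Proof.
move=> d_gt0 co_dm dvd_m; apply/and3P; split.
- by have [] := numq_denq_frac m d a d_gt0 co_dm.
- by have [] := numq_denq_frac m d b d_gt0 co_dm.
- rewrite -mulrBl -rmorphB /=.
  by have [_] := numq_denq_frac m d (a - b) d_gt0 co_dm; apply.
Qed.

Theorem mainTheorem2 (p : nat) (p_prime : prime p) (p_odd : odd p) :
  eqmodq (p ^ 2)%N
    (\sum_(0 <= k < p) (- (1 / 8%:R)) ^+ k *
      \sum_(0 <= j < k.+1)
        ('C(2 * j, j) * 'C(2 * k - 2 * j, k - j)
          * (6 * j + 1) * (6 * k - 6 * j + 1))%N%:R)
    (- (p%:R / 2%:R))
  /\
  eqmodq (p ^ 2)%N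
    (\sum_(0 <= k < p) (1 / 4%:R) ^+ k *
      \sum_(0 <= j < k.+1)
        ('C(2 * j, j) * 'C(2 * k - 2 * j, k - j)
          * (6 * j + 1) * (6 * k - 6 * j + 1))%N%:R)
    p%:R.
Proof.
have co2p : coprime 2 (p ^ 2) by rewrite coprime2n oddX p_odd orbT.
split.
- have -> : \sum_(0 <= k < p) (- (1 / 8%:R)) ^+ k *
      \sum_(0 <= j < k.+1)
        ('C(2 * j, j) * 'C(2 * k - 2 * j, k - j)
          * (6 * j + 1) * (6 * k - 6 * j + 1))%N%:R
      = (2%:Z * (3%:Z * p%:Z ^+ 2 - p%:Z))%:~R / (2 ^ p.+1)%N%:R :> rat.
    transitivity ((- 2%:R^-1) ^+ p * (p%:R - 3%:R * p%:R ^+ 2) : rat).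
      rewrite -sum_quadratic_geometric; apply: eq_bigr => k _.
      rewrite inner_sumE !mulrA -exprMn.
      by congr (_ ^+ k * _ / _).
    rewrite exprNn -signr_odd p_odd expr1 exprVn natrX (exprS _ p).
    rewrite rmorphM rmorphB rmorphM rmorphXn /=.
    have := expf_neq0 p (isT : 2%:R != 0 :> rat).
    by move: (2%:R ^+ p) => t t_neq0; field.
  have -> : - (p%:R / 2%:R)
      = (- (p%:Z * 2%:Z ^+ p))%:~R / (2 ^ p.+1)%N%:R :> rat.
    rewrite natrX (exprS _ p) rmorphN rmorphM rmorphXn /=.
    have := expf_neq0 p (isT : 2%:R != 0 :> rat).
    by move: (2%:R ^+ p) => t t_neq0; field.
  (* Over the common denominator 2^(p+1), p divides 2^p - 2 by Fermat. *)
  apply: eqmodq_frac; first by rewrite expn_gt0.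
    exact: coprimeXl.
  have -> : 2%:Z * (3%:Z * p%:Z ^+ 2 - p%:Z) - - (p%:Z * 2%:Z ^+ p)
      = 6%:Z * p%:Z ^+ 2 + p%:Z * (2%:Z ^+ p - 2%:Z) by ring.
  rewrite -[(p ^ 2)%N%:Z]natz natrX natz; apply: rpredD; first exact: dvdz_mull.
  rewrite expr2; apply: dvdz_mul => //.
  rewrite -eqz_mod_dvd -!natz -natrX !natz !modz_nat eqz_nat.
  exact/eqP/fermat_little.
- have -> : \sum_(0 <= k < p) (1 / 4%:R) ^+ k *
      \sum_(0 <= j < k.+1)
        ('C(2 * j, j) * 'C(2 * k - 2 * j, k - j)
          * (6 * j + 1) * (6 * k - 6 * j + 1))%N%:R
      = (2%:Z * p%:Z + 3%:Z * p%:Z ^+ 2 * (p%:Z - 1))%:~R / 2%:R :> rat.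
    transitivity (p%:R + 3%:R * p%:R ^+ 2 * (p%:R - 1) / 2%:R : rat).
      rewrite -sum_quadratic; apply: eq_bigr => k _.
      rewrite inner_sumE !mulrA -exprMn.
      by rewrite (_ : 1 / 4%:R * 4%:R = 1) // expr1n mul1r.
    rewrite rmorphD !rmorphM rmorphB /=.
    by field.
  have -> : p%:R = (2%:Z * p%:Z)%:~R / 2%:R :> rat.
    by rewrite rmorphM /=; field.
  apply: eqmodq_frac => //.
  have -> : 2%:Z * p%:Z + 3%:Z * p%:Z ^+ 2 * (p%:Z - 1) - 2%:Z * p%:Z
      = 3%:Z * (p%:Z - 1) * p%:Z ^+ 2 by ring.
  by rewrite -[(p ^ 2)%N%:Z]natz natrX natz dvdz_mull.
Qed.
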